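(* Let $X$, $f$, $[a,b]$, $\mathcal{G}$, $s$, $\tilde g$ and $\tilde g'$ be as described in the context, so that the conditional density of $X$ given $\mathcal{G}$ is $f(x\mid\mathcal{G})=\tilde g'(x,\mathbf{U})$ with $\mathbf{U}$ uniform over the $s$-dimensional unit cube. Suppose that $$\sup_{x\in[a,b]}V_{\mathrm{HK}}(\tilde g'(x,\cdot))<\infty .$$ Let $P_n=\{\mathbf{U}_1,\dots,\mathbf{U}_n\}$ be RQMC point sets in $[0,1)^s$ with $D^*(P_n)=\mathcal{O}((\log n)^{s-1}/n)$, and let $$\hat f_{\mathrm{cde\text{-}rqmc},n}(x)=\frac1n\sum_{i=1}^n\tilde g'(x,\mathbf{U}_i),\qquad x\in[a,b].$$ Then for any $\epsilon>0$, $$\sup_{x\in[a,b]}\mathrm{Var}[\hat f_{\mathrm{cde\text{-}rqmc},n}(x)]=\mathcal{O}(n^{-2+\epsilon})\quad (n\to\infty),$$ so the mean integrated square error $$\mathrm{MISE}(\hat f_{\mathrm{cde\text{-}rqmc},n})=\int_a^b\mathbb{E}\big[(\hat f_{\mathrm{cde\text{-}rqmc},n}(x)-f(x))^2\big]\,\mathrm{d}x$$ converges as $\mathcal{O}(n^{-2+\epsilon})$.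
   Context: **Conditional density.** $X$ is a real-valued random variable with cdf $F$ and density $f=F'$; $a<b$ are real; $\mathcal{G}$ is a sub-sigma-field, with conditional cdf $F(x\mid\mathcal{G})=\mathbb{P}[X\le x\mid\mathcal{G}]$ (regular version) and conditional density $f(x\mid\mathcal{G})=F'(x\mid\mathcal{G})=\frac{\mathrm{d}}{\mathrm{d}x}F(x\mid\mathcal{G})$ (one-sided derivative at endpoints of $[a,b]$). Standing assumption on $\mathcal{G}$: for all realizations of $\mathcal{G}$, $F(\cdot\mid\mathcal{G})$ is continuous on $[a,b]$ and differentiable except perhaps on a countable set $D(\mathcal{G})\subset[a,b]$; for every $x\in[a,b]$, $F(\cdot\mid\mathcal{G})$ is differentiable at $x$ with probability 1; and there is a random variable $\Gamma$ on the same probability space with $\mathbb{E}[\Gamma^2]<\infty$ and $\sup_{x\in[a,b]\setminus D(\mathcal{G})}F'(x\mid\mathcal{G})\le\Gamma$. **Representation by uniforms.** $s\ge1$ is a fixed integer. There is a function $\tilde g:[a,b]\times[0,1]^s\to\mathbb{R}$ such that $F(x\mid\mathcal{G})=\tilde g(x,\mathbf{U})$ and $f(x\mid\mathcal{G})=\tilde g'(x,\mathbf{U})$, where $\mathbf{U}$ is uniformly distributed over the unit cube and $\tilde g'(x,\mathbf{u})=\mathrm{d}\tilde g(x,\mathbf{u})/\mathrm{d}x$; for each $x$, $\tilde g'(x,\cdot)$ is regarded as a real function on $[0,1]^s$. **Hardy–Krause variation.** $V_{\mathrm{HK}}(g)$ is the variation in the sense of Hardy and Krause (anchored at $\mathbf{1}$)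 of $g:[0,1]^s\to\mathbb{R}$. Let $\mathcal{S}=\{1,\dots,s\}$. For $\mathfrak{v}\subseteq\mathcal{S}$, let $\mathbf{u}_{\mathfrak{v}}$ be the projection of $\mathbf{u}$ on the coordinates in $\mathfrak{v}$, let $(\mathbf{u}_{\mathfrak{v}},\mathbf{1})$ be $\mathbf{u}$ with $u_j$ replaced by $1$ for $j\notin\mathfrak{v}$, and $g_{\mathfrak{v}}=\partial^{|\mathfrak{v}|}g/\partial\mathbf{u}_{\mathfrak{v}}$. When $g_{\mathfrak{v}}$ exists and is continuous for all $\mathfrak{v}\subseteq\mathcal{S}$, $$V_{\mathrm{HK}}(g)=\sum_{\emptyset\ne\mathfrak{v}\subseteq\mathcal{S}}\int_{[0,1]^{|\mathfrak{v}|}}|g_{\mathfrak{v}}(\mathbf{u}_{\mathfrak{v}},\mathbf{1})|\,\mathrm{d}\mathbf{u}_{\mathfrak{v}}.$$ **Star discrepancy.** For an $n$-point set $P_n$, $$D^*(P_n)=\sup_{\mathbf{u}\in[0,1]^s}\left|\frac{|P_n\cap[\mathbf{0},\mathbf{u})|}{n}-\mathrm{vol}[\mathbf{0},\mathbf{u})\right|,$$ where $\mathrm{vol}[\mathbf{0},\mathbf{u})$ is the volume of the box $[\mathbf{0},\mathbf{u})$ (points counted with multiplicity). **RQMC point sets.** For each $n$ (in an infinite set of positive integers), $P_n=\{\mathbf{U}_1,\dots,\mathbf{U}_n\}$ is a randomized point set such that each $\mathbf{U}_i$ individually has the uniform distribution over $[0,1)^s$ (the points may be dependent), and the discrepancy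 bound $D^*(P_n)=\mathcal{O}((\log n)^{s-1}/n)$ holds for the randomized points, i.e., with a deterministic implied constant valid for all realizations of the randomization. *)

(* Defs.v *)
From HB Require Import structures.
From mathcomp Require Import all_boot all_order all_algebra.
From mathcomp Require Import all_classical all_reals all_analysis.

Set Implicit Arguments.
Unset Strict Implicit.
Unset Printing Implicit Defensive.

Import Order.TTheory GRing.Theory Num.Theory.
Import numFieldNormedType.Exports.

Local Open Scope classical_set_scope.
Local Open Scope ring_scope.

(* R^s is s.-tuple R with its product sigma-algebra. *)

Section HardyKrause.
Context {R : realType}.

(* Alternating sum of h over the vertices of the box [x, y]. *)
Definition mixed_diff (I : finType) (h : (I -> R) -> R) (x y : I -> R) : R :=
  \sum_(w : {set I}) (-1) ^+ #|w| * h (fun i => if i \in w then x i else y i).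

(* Vitali variation over [0,1]^I.  The partition of the i-th axis is 0 :: t i,
   so its k-th interval is [(0 :: t i)_k, (t i)_k], and the cells of the grid
   are the k : forall i, 'I_(size (t i)). *)
Definition vitali_variation (I : finType) (h : (I -> R) -> R) : \bar R :=
  ereal_sup
    [set (\sum_(k : {dffun forall i : I, 'I_(size (t i))})
            `|mixed_diff h (fun i => nth 1 (0 :: t i) (k i))
                           (fun i => nth 1 (t i) (k i))|)%:E
      | t in [set t : I -> seq R | forall i, itv_partition 0 1 (t i)]].

(* u_v |-> g (u_v, 1) *)
Definition face (s : nat) (g : s.-tuple R -> R) (v : {set 'I_s})
    (u : {j : 'I_s | j \in v} -> R) : R :=
  g [tuple oapp u 1 (insub j) | j < s].

(* Hardy-Krause variation anchored at 1, for an arbitrary g: the sum of the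
   Vitali variations of g on the faces {u | u_j = 1 for j \notin v}.  When the
   mixed partial derivatives are continuous, the v-th term is the integral of
   |g_v (u_v, 1)|. *)
Definition HK_variation (s : nat) (g : s.-tuple R -> R) : \bar R :=
  (\sum_(v : {set 'I_s} | v != finset.set0) vitali_variation (@face s g v))%E.

End HardyKrause.

Section PointSets.
Context {R : realType}.

Definition unit_cube (s : nat) : set (s.-tuple R) :=
  [set u | forall j, 0 <= tnth u j <= 1].

Definition unit_cube_ho (s : nat) : set (s.-tuple R) :=
  [set u | forall j, 0 <= tnth u j < 1].

(* The uniform distribution over the s-dimensional unit cube, i.e. the product
   of s copies of the uniform law on [0, 1], given by its values on measurable
   rectangles, which determine it. *)
Definition uniform_on_cube (s : nat) (mu : set (s.-tuple R) -> \bar R) : Prop :=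
  forall A : 'I_s -> set R, (forall j, measurable (A j)) ->
    mu [set u | forall j, A j (tnth u j)] =
    (\prod_(j < s) fine (uniform_prob (@ltr01 R) (A j)))%:E.

Definition star_discrepancy (s n : nat) (p : 'I_n -> s.-tuple R) : \bar R :=
  ereal_sup
    [set `| #|[pred i : 'I_n | [forall j, 0 <= tnth (p i) j < tnth u j]]|%:R
              / n%:R - \prod_(j < s) tnth u j |%:E
      | u in unit_cube (s := s)].

(* u n = O(v n) as n -> oo along the index set N. *)
Definition bigO_along (N : set nat) (u : nat -> \bar R) (v : nat -> R) : Prop :=
  exists K : R, \forall n \near \oo, N n -> (`|u n| <= (K * `|v n|)%:E)%E.

(* The supremum over realizations makes the implied constant deterministic. *)
Record rqmc_points (s : nat) (N : set nat) (d : measure_display)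
    (Om : nat -> measurableType d) (Q : forall n, probability (Om n) R)
    (U : forall n, 'I_n -> {RV (Q n) >-> s.-tuple R}) : Prop := {
  rqmc_range : forall n, N n -> forall (i : 'I_n) (w : Om n),
    unit_cube_ho (U n i w) ;
  rqmc_uniform : forall n, N n -> forall i : 'I_n,
    uniform_on_cube (distribution (Q n) (U n i)) ;
  rqmc_discrepancy : bigO_along N
    (fun n => ereal_sup [set star_discrepancy (fun i => U n i w)
                          | w in [set: Om n]])
    (fun n => ln n%:R ^+ s.-1 / n%:R) }.

End PointSets.

Section ConditionalDensity.
Context {R : realType}.

(* l is the derivative of h at x, computed from within [a, b]: one-sided at the
   endpoints, two-sided inside. *)
Definition derivative_on (a b : R) (h : R -> R) (x l : R) : Prop :=
  (h y - h x) / (y - x) @[y --> within `[a, b] x^'] --> l.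

(* f is a density of X, and f = F' on [a, b]. *)
Record is_density_on (a b : R) (d : measure_display) (T : measurableType d)
    (P : probability T R) (X : {RV P >-> R}) (f : R -> R) : Prop := {
  density_ge0 : forall x, 0 <= f x ;
  density_measurable : measurable_fun [set: R] f ;
  density_law : forall A : set R, measurable A ->
    distribution P X A = (\int[lebesgue_measure]_(x in A) (f x)%:E)%E ;
  density_derivative : forall x, x \in `[a, b] ->
    derivative_on a b (fun y => fine (cdf X y)) x (f x) }.

Definition sub_sigma_field (d : measure_display) (T : measurableType d)
    (G : set (set T)) : Prop :=
  sigma_algebra [set: T] G /\ G `<=` measurable.

(* Regular version of P[X <= x | G]: each realization cF w is a cdf. *)
Record is_cond_cdf (d : measure_display) (T : measurableType d)
    (P : probability T R) (G : set (set T)) (X : {RV P >-> R})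
    (cF : T -> cumulativeBounded (0 : R) (1 : R)) : Prop := {
  cond_cdf_measurable : forall x : R,
    measurable_fun [set: g_sigma_algebraType G]
      ((fun w => cF w x) : g_sigma_algebraType G -> R) ;
  cond_cdf_integral : forall (x : R) (A : set T), G A ->
    (\int[P]_(w in A) (cF w x)%:E)%E = P (A `&` X @^-1` `]-oo, x]) }.

Record cond_cdf_regularity (a b : R) (d : measure_display)
    (T : measurableType d) (P : probability T R)
    (cF : T -> cumulativeBounded (0 : R) (1 : R))
    (D : T -> set R) (Gam : {RV P >-> R}) : Prop := {
  reg_continuous : forall w, {within `[a, b], continuous (cF w)} ;
  reg_countable : forall w, countable (D w) /\ D w `<=` `[a, b] ;
  reg_derivable : forall w x, x \in `[a, b] -> ~ D w x ->
    exists l, derivative_on a b (cF w) x l ;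
  reg_ae_derivable : forall x, x \in `[a, b] ->
    {ae P, forall w, exists l, derivative_on a b (cF w) x l} ;
  reg_Gam_L2 : ('E_P[(fun w => Gam w ^+ 2)%R] < +oo)%E ;
  reg_Gam_bound : {ae P, forall w, forall x, x \in `[a, b] -> ~ D w x ->
    forall l, derivative_on a b (cF w) x l -> l <= Gam w} }.

(* gt' x is a total function on the cube: it is the x-derivative of gt wherever
   that exists and unconstrained elsewhere, so that gt' x U is F'(x | G)
   whenever the latter exists. *)
Record uniform_representation (a b : R) (s : nat) (d : measure_display)
    (T : measurableType d) (P : probability T R)
    (cF : T -> cumulativeBounded (0 : R) (1 : R)) (U : {RV P >-> s.-tuple R})
    (gt gt' : R -> s.-tuple R -> R) : Prop := {
  repr_uniform : uniform_on_cube (distribution P U) ;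
  repr_cdf : {ae P, forall w, forall x, x \in `[a, b] -> cF w x = gt x (U w)} ;
  repr_derivative : forall x u, x \in `[a, b] -> unit_cube u ->
    forall l, derivative_on a b (gt^~ u) x l -> gt' x u = l ;
  repr_measurable : forall x, x \in `[a, b] ->
    measurable_fun (unit_cube (s := s)) (gt' x) }.

Definition cde_rqmc (s n : nat) (gt' : R -> s.-tuple R -> R)
    (p : 'I_n -> s.-tuple R) (x : R) : R :=
  n%:R^-1 * \sum_(i < n) gt' x (p i).

Definition MISE (a b : R) (d : measure_display) (T : measurableType d)
    (Q : probability T R) (fhat : T -> R -> R) (f : R -> R) : \bar R :=
  (\int[lebesgue_measure]_(x in `[a, b]) 'E_Q[(fun w => (fhat w x - f x) ^+ 2)%R])%E.

End ConditionalDensity.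

(* Main.v *)
Require Import Defs.
From HB Require Import structures.
From mathcomp Require Import all_boot all_order all_algebra.
From mathcomp Require Import all_classical all_reals all_analysis.
From mathcomp Require Import measurable_realfun.
From mathcomp Require Import ring lra.

Set Implicit Arguments.
Unset Strict Implicit.
Unset Printing Implicit Defensive.

Import Order.TTheory GRing.Theory Num.Theory.
Import numFieldNormedType.Exports.

Local Open Scope classical_set_scope.
Local Open Scope ring_scope.

(** For each fixed [x] in [a, b], every realization of the estimator is within
    [D_n * M] of [f x], where [D_n = O((ln n)^(s-1) / n)] bounds the star
    discrepancy of the points and [M] bounds the Hardy-Krause variation of all
    the [gt' x].  The variance is then at most [4 (D_n M)^2], the mean
    integrated square error at most [(b - a) (D_n M)^2], and a power of [ln n]
    is absorbed by [n^eps].  Two facts give the pointwise bound.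

    The first is that [f x] is the expectation of [gt' x U]
    ([density_unbiased]).  Difference quotients of the cdf of [X] are
    expectations of difference quotients of the conditional cdf.  The latter
    converge almost surely to [gt' x U], and they lie between 0 and [Gam] by a
    mean value inequality that tolerates a countable set without derivative
    ([increment_le]), so dominated convergence applies.

    The second is the Koksma-Hlawka inequality ([koksma_hlawka]) for a variation
    that is a supremum over grids, where no derivative of the integrand can be
    integrated by parts.  Its core is a statement on finitely many weighted
    points ([koksma_hlawka_discrete]): if the weights sum to 0 and give every
    box [[0, u)] a mass of absolute value at most [dl], then the weighted sum of
    the values of [g] is at most [dl] times the variation of [g].  On a grid
    through all coordinates of the points, [g] is a sum of its mixed differences
    over the cells that are not below the point ([grid_expansionE]), and
    exchanging the two sums makes the masses of boxes appear.  To compare a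
    sample mean with an integral, the cube is cut into cells of side less than
    [h].  Each cell is represented by a point where [g] is almost maximal,
    weighted by the probability of the cell.  This weighted set dominates the
    integral and has the right mass on each box up to [s * h].  Letting [h] tend
    to 0 gives one inequality, and [- g] gives the other. *)

(** * Summation by parts on a grid *)

(** As [z] is a grid point, the cells that end above [z] are those that follow
    [z] in the grid, and the increments of [phi] over them telescope. *)
Lemma telescope_above (R : realType) (phi : R -> R) (d a z : R) (t : seq R) :
  path <%O a t -> z \in a :: t ->
  \sum_(k < size t) (phi (nth d t k) - phi (nth d (a :: t) k)) *
    (z < nth d t k)%R%:R = phi (last a t) - phi z.
Proof.
elim: t a z => [|x t IH] a z; first by rewrite big_ord0 inE => _ /eqP ->; rewrite subrr.
move=> /= /andP[ax xt]; rewrite inE big_ord_recl /= => zt.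
have xk (k : 'I_(size t)) : x < nth d t k.
  by apply: (allP (order_path_min lt_trans xt)); rewrite mem_nth.
case/orP: zt => [/eqP ->|zt].
  rewrite ax mulr1 (_ : \sum_(_ < _) _ = phi (last x t) - phi x); last first.
    rewrite -(IH x x) ?mem_head //; apply: eq_bigr => k _.
    by rewrite xk (lt_trans ax (xk k)).
  by rewrite [LHS]addrC addrA subrK.
have -> : (z < x) = false.
  move: zt; rewrite inE => /orP[/eqP ->|zt]; first by rewrite ltxx.
  by apply/negbTE; rewrite -leNgt ltW// (allP (order_path_min lt_trans xt)).
by rewrite mulr0 add0r IH.
Qed.

Lemma path_le_last (R : realType) (a x : R) (t : seq R) :
  path <%O a t -> x \in a :: t -> x <= last a t.
Proof.
elim: t a x => [|y t IH] a x /=; first by rewrite inE => _ /eqP ->.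
move=> /andP[ay yt]; rewrite inE => /orP[/eqP ->|]; last exact: IH.
exact: le_trans (ltW ay) (IH y y yt (mem_head _ _)).
Qed.

Section MixedDiff.
Variables (R : realType) (I : finType).
Implicit Types (x y : I -> R) (h : (I -> R) -> R).

(** The alternating sum over the vertices is the expansion of a product of
    differences. *)
Lemma mixed_diff_prod (phi : I -> R -> R) x y :
  mixed_diff (fun u => \prod_i phi i (u i)) x y =
  \prod_i (phi i (y i) - phi i (x i)).
Proof.
rewrite (eq_bigr (fun i => - phi i (x i) + phi i (y i))) => [|i _]; last by rewrite addrC.
rewrite bigA_distr; apply: eq_bigr => w _.
rewrite -prodr_const [\prod_(i in w) _]big_mkcond -big_split /=.
by apply: eq_bigr => i _; case: (i \in w); rewrite ?mulN1r ?mul1r.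
Qed.

Lemma mixed_diff_lin (B : finType) (c : B -> R) (h : B -> (I -> R) -> R) x y :
  mixed_diff (fun u => \sum_b c b * h b u) x y =
  \sum_b c b * mixed_diff (h b) x y.
Proof.
rewrite /mixed_diff (eq_bigr _ (fun w _ => mulr_sumr _ _ _ _)) exchange_big /=.
by apply: eq_bigr => b _; rewrite mulr_sumr; apply: eq_bigr => w _; rewrite mulrCA.
Qed.

Lemma mixed_diffZ (c : R) h x y :
  mixed_diff (fun u => c * h u) x y = c * mixed_diff h x y.
Proof. by rewrite /mixed_diff mulr_sumr; apply: eq_bigr => w _; rewrite mulrCA. Qed.

Lemma eq_mixed_diff h h' x y :
  (forall w : {set I}, h (fun i => if i \in w then x i else y i) =
                       h' (fun i => if i \in w then x i else y i)) ->
  mixed_diff h x y = mixed_diff h' x y.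
Proof. by move=> hh; apply: eq_bigr => w _; rewrite hh. Qed.

End MixedDiff.

Section GridExpansion.
Variables (R : realType) (s : nat) (t : seq R).
Hypothesis t01 : itv_partition 0 1 t.

Local Notation node := (0 :: t).

Definition cell_of (v : {set 'I_s}) : finType :=
  {dffun forall i : {j : 'I_s | j \in v}, 'I_(size t)}.

Definition lo_corner (v : {set 'I_s}) (k : cell_of v) (i : {j : 'I_s | j \in v}) : R :=
  nth 1 node (k i).

Definition hi_corner (v : {set 'I_s}) (k : cell_of v) (i : {j : 'I_s | j \in v}) : R :=
  nth 1 t (k i).

Definition cell_diff (g : s.-tuple R -> R) (v : {set 'I_s}) (k : cell_of v) : R :=
  mixed_diff (face g (v := v)) (lo_corner k) (hi_corner k).

(** For a grid point [z], being strictly below the upper corner on the axes in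
    [v] is the same as being at most the lower corner.  The strict form matches
    the half-open boxes of the star discrepancy. *)
Definition below_cell (z : s.-tuple R) (v : {set 'I_s}) (k : cell_of v) : bool :=
  [forall i : {j : 'I_s | j \in v}, tnth z (val i) < hi_corner k i].

(** The empty face contributes [g (1, ..., 1)]; the others correct for the
    coordinates of [z] that differ from 1. *)
Definition grid_expansion (g : s.-tuple R -> R) (z : s.-tuple R) : R :=
  \sum_(v : {set 'I_s}) (-1) ^+ #|v| *
    \sum_(k : cell_of v) cell_diff g k * (below_cell z k)%:R.

Lemma face_prod (phi : 'I_s -> R -> R) (v : {set 'I_s}) (u : {j | j \in v} -> R) :
  face (fun z : s.-tuple R => \prod_j phi j (tnth z j)) u =
  (\prod_(j | j \notin v) phi j 1) * \prod_i phi (val i) (u i).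
Proof.
rewrite /face (bigID (mem v)) /= mulrC; congr (_ * _).
  by apply: eq_bigr => j jv; rewrite tnth_mktuple insubF //; apply/negbTE.
rewrite (big_sub (mem v)); apply: eq_bigr => i _.
by rewrite tnth_mktuple valK.
Qed.

Lemma prod_nat_forall (I : finType) (b : pred I) :
  [forall i, b i]%:R = \prod_i (b i)%:R :> R.
Proof.
case: forallP => [bT|nb]; first by rewrite big1 // => i _; rewrite bT.
have [i /negbTE bi] : exists i, ~~ b i.
  by apply/existsP; rewrite -negb_forall; apply/forallP.
by rewrite (bigD1 i) //= bi mul0r.
Qed.

(** Write each factor as [phi j 1 - (phi j 1 - phi j z_j)] and expand the product
    over the subsets [v] of axes.  On the axes in [v] the bracket is a
    telescoping sum over the cells above [z_j], and a product of such sums is a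
    sum over the cells of the grid. *)
Lemma grid_expansion_prod (phi : 'I_s -> R -> R) (z : s.-tuple R) :
  (forall j, tnth z j \in node) ->
  grid_expansion (fun z => \prod_j phi j (tnth z j)) z = \prod_j phi j (tnth z j).
Proof.
move=> zt; case: t01 => pt /eqP lt1.
transitivity (\prod_j (- (phi j 1 - phi j (tnth z j)) + phi j 1)); last first.
  by apply: eq_bigr => j _; rewrite opprB subrK.
rewrite bigA_distr; apply: eq_bigr => v _.
transitivity ((-1) ^+ #|v| * ((\prod_(j | j \notin v) phi j 1) *
    \prod_(j in v) (phi j 1 - phi j (tnth z j)))); last first.
  rewrite [RHS](bigID (mem v)) /= mulrCA mulrC -prodr_const -big_split /=; congr (_ * _).
    by apply: eq_bigr => j ->; rewrite mulN1r.
  by apply: eq_bigr => j /negbTE ->.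
congr (_ * _); set C := \prod_(j | j \notin v) _.
rewrite (big_sub (mem v)) /=.
under [in RHS]eq_bigr => i _ do
  rewrite -[in phi _ 1]lt1 -(telescope_above (phi (val i)) 1 pt (zt (val i))).
rewrite bigA_distr_bigA mulr_sumr; apply: eq_bigr => k _.
rewrite /cell_diff (eq_mixed_diff (h' := fun u => (\prod_(j | j \notin v) phi j 1) *
    \prod_i phi (val i) (u i))); last by move=> w; rewrite face_prod.
rewrite mixed_diffZ (mixed_diff_prod (fun i => phi (val i))) -mulrA.
by rewrite /below_cell prod_nat_forall -big_split.
Qed.

(** Both sides are linear in [g] and only read its values at grid points, where
    [g] is a combination of indicators of grid points.  These indicators are
    products of functions of one coordinate, so [grid_expansion_prod] applies. *)
Lemma grid_expansionE (g : s.-tuple R -> R) (z : s.-tuple R) :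
  (forall j, tnth z j \in node) -> grid_expansion g z = g z.
Proof.
move=> zt; case: (t01) => pt /eqP lt1.
have node1 : 1 \in node by rewrite -lt1 mem_last.
pose B : finType := s.-tuple (seq_sub node).
pose pt_of (b : B) : s.-tuple R := [tuple val (tnth b j) | j < s].
pose delta (b : B) (u : s.-tuple R) : R := \prod_j (tnth u j == val (tnth b j))%:R.
have expand (u : s.-tuple R) : (forall j, tnth u j \in node) ->
    g u = \sum_b g (pt_of b) * delta b u.
  move=> un; pose b0 : B := [tuple SeqSub (un j) | j < s].
  rewrite (bigD1 b0) //= big1 ?addr0 => [|b bb0].
    rewrite (_ : pt_of b0 = u); last by apply: eq_from_tnth => j; rewrite !tnth_mktuple.
    by rewrite /delta big1 ?mulr1 // => j _; rewrite tnth_mktuple eqxx.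
  have [j ubj] : exists j, tnth u j != val (tnth b j).
    apply/existsP; apply: contra_neqT bb0; rewrite negb_exists => /forallP ub.
    apply: eq_from_tnth => j; apply: val_inj; rewrite tnth_mktuple.
    by apply/esym/eqP; rewrite -[_ == _]negbK; exact: ub.
  by rewrite /delta (bigD1 j) //= (negbTE ubj) mul0r mulr0.
rewrite (expand z zt).
transitivity (\sum_b g (pt_of b) * grid_expansion (delta b) z); last first.
  apply: eq_bigr => b _; congr (_ * _).
  exact: (grid_expansion_prod (fun j x => (x == val (tnth b j))%:R)).
rewrite (eq_bigr _ (fun b _ => mulr_sumr _ _ _ _)) exchange_big /=.
apply: eq_bigr => v _; rewrite (eq_bigr _ (fun b _ => mulrCA _ _ _)) -mulr_sumr.
congr (_ * _); rewrite (eq_bigr _ (fun b _ => mulr_sumr _ _ _ _)) exchange_big /=.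
apply: eq_bigr => k _; rewrite (eq_bigr _ (fun b _ => mulrA _ _ _)) -mulr_suml.
congr (_ * _); rewrite -mixed_diff_lin; apply: eq_mixed_diff => w.
rewrite /face expand // => j; rewrite tnth_mktuple; case: insub => //= i.
case: ifP => _; last by rewrite in_cons mem_nth ?orbT.
by rewrite mem_nth //= ltnS ltnW.
Qed.
End GridExpansion.

(** * A discrete Koksma-Hlawka inequality *)

Lemma grid_through (R : realType) (l : seq R) : exists2 t : seq R,
  itv_partition 0 1 t & forall x, x \in l -> 0 <= x < 1 -> x \in 0 :: t.
Proof.
pose r := sort <=%O (undup [seq x <- l | 0 < x < 1]).
exists (rcons r 1).
  split; last by rewrite last_rcons.
  have r01 x : x \in r -> 0 < x < 1.
    by rewrite mem_sort mem_undup mem_filter => /andP[].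
  rewrite rcons_path path_min_sorted; last by apply/allP => x /r01/andP[].
  rewrite sort_lt_sorted undup_uniq /=.
  by case/lastP: r r01 => [//|r' x] /(_ x); rewrite last_rcons mem_rcons mem_head => /(_ isT)/andP[].
move=> x xl /andP[]; rewrite le_eqVlt => /orP[/eqP <-|x0] x1; first by rewrite mem_head.
by rewrite inE mem_rcons inE mem_sort mem_undup mem_filter x0 x1 xl !orbT.
Qed.

(** Expand each [g (p i)] on a grid that contains all the coordinates of the
    points and sum over [i] first.  The coefficient of each mixed difference is
    then the mass of a box, at most [dl] in absolute value, and what remains is
    a sum of absolute mixed differences over the faces, which is bounded by the
    variation. *)
Lemma koksma_hlawka_discrete (R : realType) (s : nat) (J : finType) (c : J -> R)
    (p : J -> s.-tuple R) (g : s.-tuple R -> R) (dl M : R) :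
  (forall i, unit_cube_ho (p i)) -> \sum_i c i = 0 ->
  (forall u, unit_cube u ->
    `|\sum_i c i * [forall j, tnth (p i) j < tnth u j]%:R| <= dl) ->
  (HK_variation g <= M%:E)%E ->
  `|\sum_i c i * g (p i)| <= dl * M.
Proof.
move=> p01 c0 box gM.
have [t t01 tp] := grid_through [seq tnth (p ij.1) ij.2 | ij : J * 'I_s].
have dl0 : 0 <= dl by apply: le_trans (box [tuple 1 | j < s] _) => // j;
  rewrite tnth_mktuple ler01 lexx.
have -> : \sum_i c i * g (p i) = \sum_(v : {set 'I_s} | v != finset.set0) (-1) ^+ #|v| *
    \sum_(k : cell_of t v) cell_diff g k * \sum_i c i * (below_cell (p i) k)%:R.
  transitivity (\sum_i c i * grid_expansion t g (p i)).
    apply: eq_bigr => i _; rewrite grid_expansionE // => j; apply: tp (p01 i j).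
    by apply/mapP; exists (i, j); rewrite ?mem_enum.
  rewrite (eq_bigr _ (fun b _ => mulr_sumr _ _ _ _)) exchange_big /=.
  (* On the empty face every point has the same term, and the weights sum to 0. *)
  rewrite [LHS](bigD1 finset.set0) //= [X in X + _](_ : _ = 0) ?add0r; last first.
    pose C := (-1) ^+ #|finset.set0 : {set 'I_s}| *
      \sum_(k : cell_of t (finset.set0 : {set 'I_s})) cell_diff g k.
    transitivity (\sum_i c i * C); last by rewrite -mulr_suml c0 mul0r.
    apply: eq_bigr => i _; congr (_ * (_ * _)); apply: eq_bigr => k _.
    suff -> : below_cell (p i) k by rewrite mulr1.
    by apply/forallP => -[j j0]; exfalso; move: j0; rewrite finset.in_set0.
  apply: eq_bigr => v _; rewrite (eq_bigr _ (fun b _ => mulrCA _ _ _)) -mulr_sumr.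
  congr (_ * _); rewrite (eq_bigr _ (fun b _ => mulr_sumr _ _ _ _)) exchange_big /=.
  apply: eq_bigr => k _; rewrite mulr_sumr; apply: eq_bigr => i _.
  by rewrite mulrCA.
have [pt /eqP lt1] := t01.
have t_gt0 x : x \in t -> 0 < x by move/(allP (order_path_min lt_trans pt)).
have t_le1 x : x \in t -> x <= 1.
  by move=> xt; rewrite -lt1 path_le_last // in_cons xt orbT.
(* The box with side 1 on the axes outside v: the points have coordinates < 1. *)
have dens v (k : cell_of t v) : `|\sum_i c i * (below_cell (p i) k)%:R| <= dl.
  pose u := [tuple oapp (hi_corner k) 1 (insub j) | j < s].
  apply: le_trans (box u _) => [|j]; last first.
    rewrite tnth_mktuple; case: insub => [i|] /=; last by rewrite ler01 lexx.
    by rewrite t_le1 ?mem_nth // ltW // t_gt0 ?mem_nth.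
  rewrite le_eqVlt; apply/orP; left; apply/eqP; congr `|_|; apply: eq_bigr => i _.
  congr (_ * _%:R); congr nat_of_bool; apply/forallP/forallP => pu.
    move=> j; rewrite tnth_mktuple; case: insubP => [i' _ <-|_] /=; first exact: pu.
    by have /andP[] := p01 i j.
  by move=> i'; have := pu (val i'); rewrite tnth_mktuple valK.
apply: (@le_trans _ _ (\sum_(v : {set 'I_s} | v != finset.set0) dl *
    \sum_(k : cell_of t v) `|cell_diff g k|)).
  apply: le_trans (ler_norm_sum _ _ _) _; apply: ler_sum => v _.
  rewrite normrM normrX normrN1 expr1n mul1r mulr_sumr.
  apply: le_trans (ler_norm_sum _ _ _) _; apply: ler_sum => k _.
  by rewrite normrM mulrC ler_wpM2r.
rewrite -mulr_sumr ler_wpM2l // -lee_fin; apply: le_trans gM.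
rewrite -sumEFin; apply: lee_sum => v _; apply: ereal_sup_ubound.
by exists (fun=> t).
Qed.

(** * The cube, its boxes and its cells *)

Section Cube.
Variables (R : realType) (s : nat).
Local Notation cube_ho := (unit_cube_ho (R := R) (s := s)).

Lemma measurable_box (A : 'I_s -> set R) :
  (forall j, measurable (A j)) ->
  measurable [set u : s.-tuple R | forall j, A j (tnth u j)].
Proof.
move=> mA.
rewrite (_ : [set _ | _] = \bigcap_(j in [set: 'I_s]) ((@tnth s R ^~ j) @^-1` A j)).
  apply: fin_bigcap_measurable => [|j _]; first exact: finite_finset.
  by have := @measurable_tnth _ R s j measurableT _ (mA j); rewrite setTI.
by apply/seteqP; split => [u uA j _|u uA j]; exact: uA.
Qed.

Lemma cube_hoE : cube_ho = [set u | forall j, `[0, 1[%classic (tnth u j)].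
Proof. by apply/seteqP; split => u uA j; have := uA j; rewrite /= in_itv. Qed.

Lemma measurable_cube_ho : measurable cube_ho.
Proof. by rewrite cube_hoE; exact: (@measurable_box (fun=> `[0, 1[%classic)). Qed.

Lemma measurable_cube : measurable (unit_cube (R := R) (s := s)).
Proof.
rewrite [X in measurable X](_ : _ = [set u | forall j, `[0, 1]%classic (tnth u j)]).
  exact: (@measurable_box (fun=> `[0, 1]%classic)).
by apply/seteqP; split => u uA j; have := uA j; rewrite /= in_itv.
Qed.

Lemma sub_cube_ho : cube_ho `<=` unit_cube (s := s).
Proof. by move=> u uA j; have /andP[-> /ltW ->] := uA j. Qed.

Lemma uniform_prob_itv (y : R) : 0 <= y <= 1 ->
  uniform_prob (@ltr01 R) `[0, y[ = y%:E.
Proof.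
case/andP=> y0 y1.
rewrite /uniform_prob (eq_integral (fun=> 1%E)).
  rewrite integral_cst//= lebesgue_measure_itv/= lte_fin mul1e -EFinB subr0;
     move: y0; rewrite le_eqVlt => /orP[/eqP <-|->]; rewrite ?ltxx //.
move=> x; rewrite inE /= in_itv /= => /andP[x0 xy].
by rewrite /uniform_pdf x0 (ltW (lt_le_trans xy y1)) subr0 invr1.
Qed.

Lemma uniform_box (mu : set (s.-tuple R) -> \bar R) (y : s.-tuple R) :
  uniform_on_cube mu -> unit_cube y ->
  mu [set u | forall j, 0 <= tnth u j < tnth y j] = (\prod_j tnth y j)%:E.
Proof.
move=> Umu y01.
rewrite (_ : [set _ | _] = [set u | forall j, `[0, tnth y j[%classic (tnth u j)]).
  rewrite (Umu (fun j => `[0, tnth y j[%classic)) //; congr EFin.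
  by apply: eq_bigr => j _; rewrite uniform_prob_itv.
by apply/seteqP; split => u uA j; have := uA j; rewrite /= in_itv.
Qed.

Lemma dist_prod_le (I : finType) (x y : I -> R) (h : R) :
  (forall i, 0 <= x i <= 1) -> (forall i, 0 <= y i <= 1) ->
  (forall i, `|x i - y i| <= h) ->
  `|\prod_i x i - \prod_i y i| <= #|I|%:R * h.
Proof.
move=> x01 y01 xyh.
rewrite cardE -!big_enum /=.
have prod01 (z : I -> R) (r : seq I) : (forall i, 0 <= z i <= 1) ->
    0 <= \prod_(i <- r) z i <= 1.
  move=> z01; rewrite prodr_ge0 => [|i _]; last by have /andP[] := z01 i.
  by apply: prodr_ile1 => i _.
elim: (enum I) => [|i r IH]; first by rewrite !big_nil subrr normr0 mul0r.
rewrite !big_cons /= -natr1 mulrDl mul1r.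
have -> : x i * \prod_(j <- r) x j - y i * \prod_(j <- r) y j =
    x i * (\prod_(j <- r) x j - \prod_(j <- r) y j) +
    (x i - y i) * \prod_(j <- r) y j by ring.
apply: le_trans (ler_normD _ _) _; rewrite !normrM; apply: lerD.
  apply: le_trans IH; have /andP[xi0 xi1] := x01 i.
  by rewrite ger0_norm // ler_piMl.
have /andP[p0 p1] := prod01 _ r y01; rewrite [X in _ * X]ger0_norm //.
by apply: le_trans (xyh i); rewrite ler_piMr.
Qed.

(** Round the coordinates down to multiples of [1 / (m + 1)], with
    [1 / (m + 1) < h]. *)
Lemma cube_cells (h : R) : 0 < h -> exists (K : finType) (kappa : s.-tuple R -> K),
  (forall k, measurable (cube_ho `&` kappa @^-1` [set k])) /\
  {in cube_ho &, forall u v, kappa u = kappa v ->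
    forall j, `|tnth u j - tnth v j| < h}.
Proof.
move=> h0; pose m := Num.truncn h^-1.
have hm : m.+1%:R^-1 < h.
  rewrite -[ltRHS]invrK ltf_pV2 ?posrE ?invr_gt0 //.
  have hV0 : 0 <= h^-1 by rewrite invr_ge0 ltW.
  by have /andP[] := truncn_itv hV0.
pose kappa (u : s.-tuple R) : {ffun 'I_s -> 'I_m.+1} :=
  [ffun j => inord (Num.truncn (m.+1%:R * tnth u j))].
have kappaE u j : cube_ho u ->
    (kappa u j)%:R <= m.+1%:R * tnth u j < (kappa u j).+1%:R.
  move=> u01; have /andP[u0 u1] := u01 j.
  have mu0 : 0 <= m.+1%:R * tnth u j by rewrite mulr_ge0.
  rewrite ffunE inordK; first exact: truncn_itv.
  by rewrite truncn_lt_nat // gtr_pMr.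
exists {ffun 'I_s -> 'I_m.+1}, kappa; split=> [k|u v].
  pose A j : set R := `[(k j)%:R / m.+1%:R, (k j).+1%:R / m.+1%:R[%classic.
  rewrite (_ : _ `&` _ = cube_ho `&` [set u | forall j, A j (tnth u j)]).
    by apply: measurableI; [exact: measurable_cube_ho|by apply: (@measurable_box A) => j; exact: measurable_itv].
  apply/seteqP; split => u [u01 uk]; split=> //.
    move=> j; rewrite /A /= in_itv /= ler_pdivrMr // ltr_pdivlMr //.
    by rewrite mulrC -uk; exact: kappaE.
  apply/ffunP => j; apply/val_inj => /=.
  have := uk j; rewrite /A /= in_itv /= ler_pdivrMr // ltr_pdivlMr // mulrC.
  have := kappaE u j u01; move=> /andP[a1 a2] /andP[b1 b2].
  apply/eqP; rewrite eqn_leq; apply/andP.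
  by split; rewrite -ltnS -(ltr_nat R); [exact: le_lt_trans a1 b2|exact: le_lt_trans b1 a2].
rewrite !inE => u01 v01 uv j.
have := kappaE u j u01; rewrite uv; have := kappaE v j v01.
move=> /andP[a1 a2] /andP[b1 b2].
apply: lt_trans hm; rewrite -[ltRHS]mul1r ltr_pdivlMr // mulrC.
rewrite -[X in X * _](@ger0_norm R) // -normrM mulrBr.
rewrite ltr_norml; apply/andP; split; rewrite -natr1 in a2 b2; lra.
Qed.

End Cube.

Section FiniteValued.
Context (d : measure_display) (T : measurableType d) (R : realType).
Variables (P : probability T R) (E : set T) (K : finType) (kappa : T -> K).
Hypothesis mE : measurable E.
Hypothesis mk : forall k, measurable (E `&` kappa @^-1` [set k]).

Lemma integrable_finite_valued (phi : K -> R) :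
  P.-integrable E (EFin \o (phi \o kappa)).
Proof.
apply: measurable_bounded_integrable => //.
- by rewrite (le_lt_trans (probability_le1 _ _)) ?ltry.
- move=> _ Y mY.
  rewrite (_ : _ `&` _ = \bigcup_(k in [set k | Y (phi k)]) (E `&` kappa @^-1` [set k])).
    by apply: fin_bigcup_measurable => //; exact: finite_finset.
  apply/seteqP; split=> [w [Ew Yw]|w [k Yk [Ew kw]]]; first by exists (kappa w).
  by split=> //; rewrite /= kw.
- exists (\sum_k `|phi k|); split; first exact: num_real.
  move=> x xM w _ /=; apply: le_trans (ltW xM).
  by rewrite (bigD1 (kappa w)) //= lerDl sumr_ge0.
Qed.

Lemma Rintegral_finite_valued (phi : K -> R) :
  \int[P]_(w in E) phi (kappa w) =
  \sum_k phi k * fine (P (E `&` kappa @^-1` [set k])).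
Proof.
rewrite /Rintegral.
transitivity (fine (\int[P]_(w in E)
    (\sum_k (phi k)%:E * (\1_(E `&` kappa @^-1` [set k]) w)%:E))%E).
  congr fine; apply: eq_integral => w /set_mem Ew.
  rewrite (bigD1 (kappa w)) //= big1 => [|k kw].
    by rewrite adde0 indicE mem_set // mule1.
  by rewrite indicE memNset ?mule0 // => -[_ /= wk]; rewrite wk eqxx in kw.
have ind_int k : P.-integrable E (fun w => (\1_(E `&` kappa @^-1` [set k]) w)%:E).
  by apply: integrableS (integrable_indic P (mk k)) => //; exact: measurableT.
rewrite integral_sum // => [|k]; last exact: integrableZl.
rewrite (eq_bigr (fun k => (phi k * fine (P (E `&` kappa @^-1` [set k])))%:E)).
  by rewrite sumEFin.
move=> k _; rewrite integralZl // integral_indic // setIAC setIid EFinM fineK //.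
exact: fin_num_measure.
Qed.

End FiniteValued.
(** * The Koksma-Hlawka inequality *)

Lemma clip_up_close (R : realType) (x h : R) : 0 <= x <= 1 -> 0 <= h ->
  `|Num.min (x + h) 1 - x| <= h.
Proof.
move=> /andP[x0 x1] h0; rewrite ler_norml.
by case: (leP (x + h) 1) => ?; apply/andP; split; lra.
Qed.

Lemma clip_down_close (R : realType) (x h : R) : 0 <= x <= 1 -> 0 <= h ->
  `|x - Num.max (x - h) 0| <= h.
Proof.
move=> /andP[x0 x1] h0; rewrite ler_norml.
by case: (leP (x - h) 0) => ?; apply/andP; split; lra.
Qed.

Section KoksmaHlawka.
Context (R : realType) (s : nat).
Implicit Types (g : s.-tuple R -> R).
Local Notation cube_ho := (unit_cube_ho (R := R) (s := s)).

Lemma HK_variationN g : HK_variation (fun u => - g u) = HK_variation g.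
Proof.
apply: eq_bigr => v _; rewrite /vitali_variation; congr ereal_sup.
congr image; apply/funext => t /=; congr EFin; apply: eq_bigr => k _.
rewrite -[RHS]normrN; congr `|_|; rewrite /mixed_diff -sumrN.
by apply: eq_bigr => w _; rewrite mulrN.
Qed.

Lemma HK_variation_ge0 g : (0 <= HK_variation g)%E.
Proof.
apply: sume_ge0 => v _; apply: (le_trans _ (ereal_sup_ubound _)); last first.
  by exists (fun=> [:: 1]) => // i; apply: itv_partition1; exact: ltr01.
by rewrite lee_fin sumr_ge0.
Qed.

(** Two unit masses of opposite signs give every box a mass in [{-1, 0, 1}]. *)
Lemma HK_bounded g (M : R) : (HK_variation g <= M%:E)%E ->
  {in cube_ho &, forall u v, `|g u - g v| <= M}.
Proof.
move=> gM u v; rewrite !inE => u01 v01.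
pose c (b : bool) : R := (-1) ^+ b; pose p (b : bool) := if b then v else u.
have sumc (F : s.-tuple R -> R) : \sum_b c b * F (p b) = F u - F v.
  by rewrite big_bool /c /p /= expr0 expr1 mul1r mulN1r addrC.
rewrite -sumc -[leRHS]mul1r; apply: koksma_hlawka_discrete gM; first by case.
  by rewrite big_bool /c /= expr0 expr1 addNr.
move=> w _; rewrite (sumc (fun x => [forall j, tnth x j < tnth w j]%:R)).
by do 2 case: [forall _, _]; rewrite ?subrr ?subr0 ?sub0r ?normrN ?normr0 ?normr1.
Qed.

Section Random.
Context (d : measure_display) (T : measurableType d) (P : probability T R).
Variables (U : {RV P >-> s.-tuple R}).
Hypothesis HU : uniform_on_cube (distribution P U).

Local Notation E := (U @^-1` cube_ho).

Lemma measurable_in_cube : measurable E.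
Proof. by rewrite -[E]setTI; apply: measurable_funP => //; exact: measurable_cube_ho. Qed.

Lemma prob_box (y : s.-tuple R) : unit_cube y ->
  P [set w | forall j, 0 <= tnth (U w) j < tnth y j] = (\prod_j tnth y j)%:E.
Proof. exact: uniform_box HU. Qed.

Lemma prob_in_cube : P E = 1%E.
Proof.
pose y : s.-tuple R := [tuple 1 | j < s].
have y1 j : tnth y j = 1 by rewrite tnth_mktuple.
have := @prob_box y; rewrite big1 // => <-; last by move=> j; rewrite y1 ler01 lexx.
congr (P _); apply/seteqP; split => w wE j; have := wE j; by rewrite y1.
Qed.

Lemma Rintegral_in_cube_cst (r : R) : \int[P]_(w in E) r = r.
Proof.
rewrite Rintegral_cst; last exact: measurable_in_cube.
rewrite -[RHS]mulr1; congr (_ * _); have := prob_in_cube.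
by move=> /(congr1 fine).
Qed.

Lemma integrable_HK g (M : R) : measurable_fun (unit_cube (s := s)) g ->
  (HK_variation g <= M%:E)%E -> P.-integrable E (EFin \o (g \o U)).
Proof.
move=> mg gM; have mE := measurable_in_cube.
apply: measurable_bounded_integrable => //.
- by rewrite (le_lt_trans (probability_le1 _ _)) ?ltry.
- apply: (measurable_comp (@measurable_cube R s)) mg _; last exact: measurable_funTS.
  by move=> _ [w Ew <-]; exact: sub_cube_ho.
- pose z : s.-tuple R := [tuple 0 | j < s].
  have z01 : z \in cube_ho by rewrite inE => j; rewrite tnth_mktuple lexx ltr01.
  exists (M + `|g z|); split; first exact: num_real.
  move=> x xM w Ew /=; apply: le_trans (ltW xM).
  rewrite -[g (U w)](subrK (g z)); apply: le_trans (ler_normD _ _) _.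
  by rewrite lerD2r (HK_bounded gM) // inE.
Qed.

(** The weights are [1 / n] at the points of the sample and minus the probability
    of a cell at a near-maximiser of [g] in that cell.  Moving a point within its
    cell changes its coordinates by less than [h], so the weight of the cells
    represented in [[0, u)] lies between the volumes of the boxes with corners
    [u - h] and [u + h], clipped to the cube. *)
Lemma koksma_hlawka_upper g (n : nat) (p : 'I_n -> s.-tuple R) (M D : R) :
  (0 < n)%N -> (forall i, cube_ho (p i)) ->
  measurable_fun (unit_cube (s := s)) g -> (HK_variation g <= M%:E)%E ->
  (star_discrepancy p <= D%:E)%E ->
  \int[P]_(w in E) g (U w) - n%:R^-1 * \sum_(i < n) g (p i) <= D * M.
Proof.
move=> n0 p01 mg gM pD; have mE := measurable_in_cube.
have M0 : 0 <= M by rewrite -lee_fin (le_trans (HK_variation_ge0 g)).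
apply/ler_addgt0Pr => e e0.
(* With this side, the error s * h on boxes costs at most e / 2; the choice of
   near-maximisers costs another e / 2. *)
pose h := e / 2 / (s%:R * M + 1).
have sM1 : 0 < s%:R * M + 1 by rewrite ltr_wpDl // mulr_ge0.
have h0 : 0 < h by rewrite !divr_gt0.
have [K [kappa [mk kappah]]] := @cube_cells R s h h0.
pose z : s.-tuple R := [tuple 0 | j < s].
have z01 : cube_ho z by move=> j; rewrite tnth_mktuple lexx ltr01.
(* A cell may be empty: its representative is then arbitrary, as its weight is 0. *)
pose near_max k v := cube_ho v /\
  forall u, cube_ho u -> kappa u = k -> kappa v = k /\ g u <= g v + e / 2.
have /choice[q qP] : forall k, exists v, near_max k v.
  move=> k.
  have [[u0 [u001 u0k]]|Nk] := pselect (exists u, cube_ho u /\ kappa u = k); last first.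
    by exists z; split=> // u u01 uk; exfalso; apply: Nk; exists u.
  pose S := g @` [set u | cube_ho u /\ kappa u = k].
  have supS : has_sup S.
    split; first by exists (g u0), u0.
    exists (g z + M) => _ [u [u01 _] <-].
    rewrite -lerBlDl; apply: le_trans (ler_norm _) _.
    by apply: (HK_bounded gM); rewrite inE.
  have [_ [u1 [u101 u1k] <-] Su1] := sup_adherent (divr_gt0 e0 (ltr0Sn R 1)) supS.
  exists u1; split=> // u u01 uk; split=> //.
  rewrite -lerBlDr; apply: le_trans (ltW Su1); rewrite lerD2r.
  by apply: sup_ubound; [exact: supS.2|exists u].
have mkU k : measurable (E `&` (kappa \o U) @^-1` [set k]).
  have := @measurable_funP _ _ _ _ setT U measurableT _ (mk k).
  by rewrite setTI.
pose wt k : R := fine (P (E `&` (kappa \o U) @^-1` [set k])).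
have wtE (phi : K -> R) : \int[P]_(w in E) phi (kappa (U w)) = \sum_k phi k * wt k.
  exact: Rintegral_finite_valued.
pose c (i : 'I_n + K) : R := match i with inl _ => n%:R^-1 | inr k => - wt k end.
pose p' (i : 'I_n + K) := match i with inl i => p i | inr k => q k end.
have csum (F : s.-tuple R -> R) : \sum_i c i * F (p' i) =
    n%:R^-1 * \sum_(i < n) F (p i) - \int[P]_(w in E) F (q (kappa (U w))).
  rewrite big_sumType /= -mulr_sumr (wtE (F \o q)) -sumrN; congr (_ + _).
  by apply: eq_bigr => k _; rewrite mulNr mulrC.
have nV : n%:R^-1 * n%:R = 1 :> R by rewrite mulVf // pnatr_eq0 -lt0n.
have c0 : \sum_i c i = 0.
  transitivity (\sum_i c i * (fun=> 1) (p' i)); first by apply: eq_bigr => i _; rewrite mulr1.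
  by rewrite (csum (fun=> 1)) Rintegral_in_cube_cst sumr_const card_ord nV subrr.
have := @koksma_hlawka_discrete R s _ c p' g (D + s%:R * h) M _ c0 _ gM.
rewrite (csum g) => kh.
have gint := integrable_HK mg gM.
have fvint (phi : K -> R) : P.-integrable E (EFin \o (fun w => phi (kappa (U w)))).
  exact: (@integrable_finite_valued _ _ _ P E K (kappa \o U)).
have qint := fvint (g \o q).
have up : \int[P]_(w in E) g (U w) <= \int[P]_(w in E) g (q (kappa (U w))) + e / 2.
  have e2int : P.-integrable E (EFin \o cst (e / 2)) by exact: finite_measure_integrable_cst.
  rewrite -[X in _ + X]Rintegral_in_cube_cst -RintegralD //; apply: le_Rintegral => //.
    exact: (integrableD mE qint e2int).
  by move=> w Ew; have [_ /(_ _ Ew erefl)[]] := qP (kappa (U w)).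
have shM : s%:R * h * M <= e / 2.
  rewrite -[leRHS](@divfK _ (s%:R * M + 1)) ?gt_eqF // mulrAC mulrC.
  by rewrite ler_wpM2l ?ltW // ltrDl ltr01.
suff : `|n%:R^-1 * \sum_(i < n) g (p i) - \int[P]_(w in E) g (q (kappa (U w)))| <=
    (D + s%:R * h) * M.
  rewrite ler_norml mulrDl => /andP[lo _]; lra.
apply: kh.
  by case=> [i|k]; [exact: p01|have [] := qP k].
move=> u u01; rewrite (csum (fun x => [forall j, tnth x j < tnth u j]%:R)).
set I := \int[P]_(w in E) _; set A := _ * _.
have Ad : `|A - \prod_j tnth u j| <= D.
  rewrite -lee_fin; apply: le_trans pD; apply: ereal_sup_ubound.
  exists u => //; congr EFin; congr `|_ - _|; rewrite /A [RHS]mulrC; congr (_ * _).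
  rewrite -sum1_card big_mkcond natr_sum; apply: eq_bigr => i _.
  rewrite inE -(_ : [forall j, tnth (p i) j < tnth u j] = [forall j, 0 <= tnth (p i) j < tnth u j]).
    by case: [forall _, _].
  by apply: eq_forallb => j; have /andP[-> _] := p01 i j.
suff Id : `|\prod_j tnth u j - I| <= s%:R * h.
  rewrite (_ : A - I = (A - \prod_j tnth u j) + (\prod_j tnth u j - I)); last by ring.
  by apply: le_trans (ler_normD _ _) _; apply: lerD.
have close w : E w -> forall j, `|tnth (q (kappa (U w))) j - tnth (U w) j| < h.
  move=> Ew; have [q01 /(_ _ Ew erefl)[qk _]] := qP (kappa (U w)).
  by apply: kappah; rewrite ?inE.
pose box y := [set w | forall j, 0 <= tnth (U w) j < tnth y j].
have mbox y : measurable (box y).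
  rewrite (_ : box y = U @^-1` [set u | forall j, `[0, tnth y j[%classic (tnth u j)]).
    rewrite -[X in measurable X]setTI; apply: measurable_funP => //.
    exact: (@measurable_box R s (fun j => `[0, tnth y j[%classic)).
  by apply/seteqP; split=> w yw j; have := yw j; rewrite /= in_itv.
have Ibox y : unit_cube y -> \int[P]_(w in E) \1_(box y) w = \prod_j tnth y j.
  move=> y01; rewrite /Rintegral integral_indic // setIidl.
    by have /(congr1 fine) := prob_box y01.
  by move=> w yw j; have /andP[-> /lt_le_trans ->] := yw j; have /andP[] := y01 j.
have boxint y : P.-integrable E (EFin \o \1_(box y)).
  by apply: integrableS (integrable_indic P (mbox y)) => //; exact: measurableT.
have Iint := fvint (fun k => [forall j, tnth (q k) j < tnth u j]%:R).
pose yu : s.-tuple R := [tuple Num.min (tnth u j + h) 1 | j < s].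
pose yd : s.-tuple R := [tuple Num.max (tnth u j - h) 0 | j < s].
have yu01 : unit_cube yu.
  move=> j; rewrite tnth_mktuple; have /andP[u0 u1] := u01 j.
  by rewrite le_min ler01 ge_min lexx orbT !andbT addr_ge0 // ltW.
have yd01 : unit_cube yd.
  move=> j; rewrite tnth_mktuple; have /andP[u0 u1] := u01 j.
  by rewrite le_max lexx orbT /= ge_max ler01 andbT lerBlDr (le_trans u1) // lerDl ltW.
have Iu : I <= \prod_j tnth yu j.
  rewrite -Ibox //; apply: le_Rintegral => // w Ew; rewrite indicE.
  case: forallP => [qu|_] /=; last exact: ler0n.
  rewrite mem_set // => j; have /andP[-> U1] := Ew j.
  rewrite tnth_mktuple lt_min U1 andbT.
  by have := close w Ew j; have := qu j; rewrite ltr_norml => ? /andP[]; lra.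
have Il : \prod_j tnth yd j <= I.
  rewrite -Ibox //; apply: le_Rintegral => // w Ew; rewrite indicE.
  case: (boolP (w \in box yd)) => [/set_mem wy|_] /=; last exact: ler0n.
  case: forallP => // -[] j; have /andP[U0] := wy j.
  rewrite tnth_mktuple lt_max [X in _ || X]ltNge U0 orbF.
  by have := close w Ew j; rewrite ltr_norml => /andP[]; lra.
have du : `|\prod_j tnth yu j - \prod_j tnth u j| <= s%:R * h.
  rewrite -[X in X%:R * _]card_ord; apply: dist_prod_le => // j.
  by rewrite tnth_mktuple clip_up_close // ltW.
have dd : `|\prod_j tnth u j - \prod_j tnth yd j| <= s%:R * h.
  rewrite -[X in X%:R * _]card_ord; apply: dist_prod_le => // j.
  by rewrite tnth_mktuple clip_down_close // ltW.
have /andP[_ du'] : - (s%:R * h) <= \prod_j tnth yu j - \prod_j tnth u j <= s%:R * h.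
  by rewrite -ler_norml.
have /andP[_ dd'] : - (s%:R * h) <= \prod_j tnth u j - \prod_j tnth yd j <= s%:R * h.
  by rewrite -ler_norml.
rewrite ler_norml lerNl opprB (le_trans _ du') ?lerD2r //=.
by rewrite (le_trans _ dd') // lerD2l lerN2.
Qed.

(** Negation preserves the variation, so the one-sided bound for [g] and [- g]
    gives both sides. *)
Theorem koksma_hlawka g (n : nat) (p : 'I_n -> s.-tuple R) (M D : R) :
  (0 < n)%N -> (forall i, cube_ho (p i)) ->
  measurable_fun (unit_cube (s := s)) g -> (HK_variation g <= M%:E)%E ->
  (star_discrepancy p <= D%:E)%E ->
  `|n%:R^-1 * \sum_(i < n) g (p i) - \int[P]_(w in E) g (U w)| <= D * M.
Proof.
move=> n0 p01 mg gM pD; rewrite ler_norml; apply/andP; split.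
  have := koksma_hlawka_upper n0 p01 mg gM pD; lra.
have mgN : measurable_fun (unit_cube (s := s)) (fun u => - g u).
  exact: measurable_funN.
have gNM : (HK_variation (fun u => - g u)%R <= M%:E)%E by rewrite HK_variationN.
have := koksma_hlawka_upper n0 p01 mgN gNM pD.
have -> : \int[P]_(w in E) (- g (U w)) = - \int[P]_(w in E) g (U w).
  transitivity (\int[P]_(w in E) (-1 * g (U w))).
    by apply: eq_Rintegral => w _; rewrite mulN1r.
  rewrite RintegralZl ?mulN1r //; first exact: measurable_in_cube.
  exact: integrable_HK gM.
rewrite sumrN; lra.
Qed.

End Random.
End KoksmaHlawka.
(** * Increments of a function with bounded derivative off a countable set *)

Section Increments.
Variables (R : realType) (a b : R) (F : R -> R).

Lemma derivative_on_near (x l : R) : derivative_on a b F x l -> forall e, 0 < e ->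
  exists2 r, 0 < r & forall y, y \in `[a, b] -> y != x -> `|x - y| < r ->
    `|l - (F y - F x) / (y - x)| < e.
Proof.
move=> /cvgrPdist_lt dF e e0; have := dF e e0.
rewrite near_withinE => /nbhs_ballP[r /= r0 ball_r]; exists r => // y yab yx xyr.
exact: (ball_r y xyr yx yab).
Qed.

Lemma continuous_on_near : {within `[a, b], continuous F} ->
  forall x, x \in `[a, b] -> forall e, 0 < e -> exists2 r, 0 < r &
    forall y, y \in `[a, b] -> `|x - y| < r -> `|F x - F y| < e.
Proof.
move=> /subspace_continuousP cF x xab e e0.
have /cvgrPdist_lt/(_ e e0) := cF x xab.
rewrite near_withinE => /nbhs_ballP[r /= r0 ball_r]; exists r => // y yab xyr.
exact: (ball_r y xyr yab).
Qed.
End Increments.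

(** If the inequality failed, some slope [C' > C] would give
    [h t = F t - C' t] with [h x < h y].  For each level [c] strictly between,
    the last point [tau] where [h <= c] satisfies [h tau = c] and [h > c] on its
    right, so [F] has no derivative at most [C] at [tau], and [tau] is in [D].
    Then [h] maps the countable set [D] onto a set that contains an interval. *)
Lemma increment_le (R : realType) (a b : R) (F : R -> R) (D : set R) (C x y : R) :
  {within `[a, b], continuous F} -> countable D ->
  (forall t, t \in `[a, b] -> ~ D t -> exists2 l, derivative_on a b F t l & l <= C) ->
  x \in `[a, b] -> y \in `[a, b] -> x <= y -> F y - F x <= C * (y - x).
Proof.
move=> cF cD dF xab yab xy; rewrite leNgt; apply/negP => incr.
have {xy} xy : x < y.
  rewrite lt_neqAle xy andbT; apply: contraTneq incr => ->.
  by rewrite !subrr mulr0 ltxx.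
have yx0 : 0 < y - x by rewrite subr_gt0.
pose q := (F y - F x) / (y - x).
pose C' := (C + q) / 2.
have Cq : C < q by rewrite /q ltr_pdivlMr.
have CC' : C < C' by rewrite midf_lt.
have C'q : C' < q by rewrite midf_lt.
pose h t := F t - C' * t.
have hxy : h x < h y.
  have : C' * (y - x) < F y - F x by rewrite -ltr_pdivlMr.
  by rewrite /h; lra.
have sub t : x <= t <= y -> t \in `[a, b].
  move=> /andP[xt ty]; move: xab yab; rewrite !in_itv /= => /andP[ax _] /andP[_ yb].
  by rewrite (le_trans ax xt) (le_trans ty yb).
have hcont t : x <= t <= y -> forall e, 0 < e -> exists2 r, 0 < r &
    forall u, x <= u <= y -> `|t - u| < r -> `|h t - h u| < e.
  move=> txy e e0.
  have [r1 r10 r1P] := continuous_on_near cF (sub t txy) (divr_gt0 e0 (ltr0Sn R 1)).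
  pose K := `|C'| + 1.
  have K0 : 0 < K by rewrite ltr_wpDl.
  exists (Num.min r1 (e / 2 / K)); first by rewrite lt_min r10 !divr_gt0.
  move=> u uxy; rewrite lt_min => /andP[tu1 tu2].
  rewrite (_ : h t - h u = (F t - F u) - C' * (t - u)); last by rewrite /h; ring.
  apply: le_lt_trans (ler_normB _ _) _; rewrite [e]splitr; apply: ltrD.
    by apply: r1P => //; exact: sub.
  move: tu2; rewrite ltr_pdivlMr // => tu2.
  apply: le_lt_trans tu2; rewrite normrM mulrC ler_wpM2l //.
  by rewrite lerDl.
have level : `](h x), (h y)[ `<=` h @` D.
  move=> c; rewrite /= in_itv /= => /andP[xc cy].
  pose S := [set t | x <= t <= y /\ h t <= c].
  have Sx : S x by split; [rewrite lexx ltW|exact: ltW].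
  have supS : has_sup S by split; [exists x|exists y => t [/andP[]]].
  pose tau := sup S.
  have xtau : x <= tau by apply: ub_le_sup => //; exact: supS.2.
  have tauy : tau <= y by apply: ge_sup; [exists x|move=> t [/andP[]]].
  have txy : x <= tau <= y by rewrite xtau tauy.
  have above t : tau < t -> t <= y -> c < h t.
    move=> taut ty; rewrite ltNge; apply/negP => htc.
    have : t <= tau.
      apply: ub_le_sup; first exact: supS.2.
      by split=> //; rewrite (le_trans xtau (ltW taut)).
    by rewrite leNgt taut.
  have htauc : h tau = c.
    apply/eqP; rewrite eq_le; apply/andP; split; rewrite leNgt; apply/negP => hc.
      have [r r0 rP] := hcont tau txy (h tau - c) ltac:(by rewrite subr_gt0).
      have [t [tS htc] ttau] := sup_adherent r0 supS.
      have ttau' : t <= tau by apply: ub_le_sup; [exact: supS.2|split].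
      have := rP t tS; rewrite ger0_norm ?subr_ge0 //.
      rewrite ltrBlDl -ltrBlDr => /(_ ttau).
      by rewrite ltr_norml => /andP[_]; lra.
    have [r r0 rP] := hcont tau txy (c - h tau) ltac:(by rewrite subr_gt0).
    have tauy' : tau < y.
      by rewrite lt_neqAle tauy andbT; apply: contraTneq hc => ->; rewrite -leNgt ltW.
    pose t := Num.min y (tau + r / 2).
    have taut : tau < t by rewrite lt_min tauy' ltrDl divr_gt0.
    have ty : t <= y by rewrite ge_min lexx.
    have tr : t <= tau + r / 2 by rewrite ge_min lexx orbT.
    have := above t taut ty; have := rP t.
    rewrite (le_trans xtau (ltW taut)) ty => /(_ isT).
    rewrite ltr0_norm ?subr_lt0 // opprB => tr'.
    have : t - tau < r by lra.
    by move=> /tr'; rewrite ltr_norml => /andP[+ _]; lra.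
  exists tau => //; apply: contrapT => nD.
  have [l dl lC] := dF tau (sub tau txy) nD.
  have tauy' : tau < y.
    by rewrite lt_neqAle tauy andbT; apply: contraTneq cy => <-; rewrite htauc ltxx.
  have [r r0 rP] := derivative_on_near dl (e := C' - C) ltac:(by rewrite subr_gt0).
  pose t := Num.min y (tau + r / 2).
  have taut : tau < t by rewrite lt_min tauy' ltrDl divr_gt0.
  have ty : t <= y by rewrite ge_min lexx.
  have tr : t <= tau + r / 2 by rewrite ge_min lexx orbT.
  have tab : t \in `[a, b] by apply: sub; rewrite (le_trans xtau (ltW taut)).
  have := rP t tab; rewrite gt_eqF // => /(_ isT).
  rewrite ltr0_norm ?subr_lt0 // opprB => rP'.
  have : t - tau < r by lra.
  move=> /rP'; rewrite ltr_norml => /andP[+ _].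
  rewrite ltrBrDl => qt.
  have : (F t - F tau) / (t - tau) < C' by lra.
  rewrite ltr_pdivrMr ?subr_gt0 //.
  by have := above t taut ty; rewrite -htauc /h; lra.
have : lebesgue_measure (`](h x), (h y)[%classic : set R) = 0%E.
  apply: countable_lebesgue_measure0; apply: sub_countable (subset_card_le level) _.
  by apply: sub_countable cD; exact: card_image_le.
rewrite lebesgue_measure_itv /= lte_fin hxy -EFinB => -[] /eqP.
by rewrite subr_eq0 gt_eqF.
Qed.
(** * The estimator is unbiased *)

Lemma cumulative_ge0 (R : realType) (F : cumulativeBounded (0 : R) (1 : R)) (x : R) :
  0 <= F x.
Proof.
rewrite leNgt; apply/negP => Fx0.
have /cvgrPdist_lt/(_ (- F x)) := cumulativeNy F.
rewrite oppr_gt0 => /(_ Fx0)[M [_ MP]].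
pose t := Num.min x (M - 1).
have tx : t <= x by rewrite ge_min lexx.
have /MP : t < M by rewrite gt_min ltrBlDr ltrDl ltr01 orbT.
rewrite sub0r normrN ltr_norml => /andP[+ _]; rewrite opprK ltNge.
by rewrite (cumulative_is_nondecreasing F).
Qed.

Section CondDensity.
Context (R : realType) (a b : R) (hab : a < b) (s : nat).
Context (d : measure_display) (T : measurableType d) (P : probability T R).
Context (X : {RV P >-> R}) (f : R -> R) (hf : is_density_on a b X f).
Context (G : set (set T)) (hG : sub_sigma_field G).
Context (cF : T -> cumulativeBounded (0 : R) (1 : R)) (hcF : is_cond_cdf G X cF).

(** The conditional cdf is measurable for [G], hence for the larger
    sigma-field. *)
Lemma measurable_cond_cdf (x : R) : measurable_fun [set: T] (fun w => cF w x).
Proof.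
move=> _ Y mY; have := cond_cdf_measurable hcF x measurableT mY.
rewrite !setTI => GY; apply: hG.2.
exact: (smallest_sub hG.1 (fun A GA => GA) GY).
Qed.

Lemma integral_cond_cdf (x : R) : (\int[P]_w (cF w x)%:E = cdf X x)%E.
Proof.
have GT : G setT by case: hG => [[G0 GC _] _]; rewrite -[setT]setD0; exact: GC.
by rewrite (cond_cdf_integral hcF x GT) setTI.
Qed.

Lemma integrable_cond_cdf (x : R) : P.-integrable setT (EFin \o (fun w => cF w x)).
Proof.
apply/integrableP; split; first by apply/measurable_EFinP; exact: measurable_cond_cdf.
under eq_integral do rewrite /= ger0_norm ?cumulative_ge0 //.
rewrite integral_cond_cdf; apply: le_lt_trans (ltry 1).
exact: probability_le1.
Qed.

Lemma integral_quotient (x y : R) :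
  (\int[P]_w ((cF w y - cF w x) / (y - x))%:E =
   ((fine (cdf X y) - fine (cdf X x)) / (y - x))%:E)%E.
Proof.
have fin z : cdf X z \is a fin_num by rewrite /cdf fin_num_measure.
transitivity (\int[P]_w ((y - x)^-1%:E * ((cF w y)%:E - (cF w x)%:E)))%E.
  by apply: eq_integral => w _; rewrite -EFinB -EFinM mulrC.
rewrite integralZl //; last first.
  exact: (integrableB _ (integrable_cond_cdf y) (integrable_cond_cdf x)).
rewrite integralB_EFin //; [|exact: integrable_cond_cdf..].
by rewrite !integral_cond_cdf -[in LHS](fineK (fin y)) -[in LHS](fineK (fin x)) -EFinB -EFinM mulrC.
Qed.

Context (D : T -> set R) (Gam : {RV P >-> R}).
Context (hreg : cond_cdf_regularity a b cF D Gam).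

(** Monotonicity bounds the quotients below by 0 and [increment_le] bounds them
    above. *)
Lemma quotient_le : {ae P, forall w, forall x y, x \in `[a, b] -> y \in `[a, b] ->
  y != x -> `|(cF w y - cF w x) / (y - x)| <= Gam w}.
Proof.
apply: filterS (reg_Gam_bound hreg) => w Gw.
have incr x y : x \in `[a, b] -> y \in `[a, b] -> x < y ->
    `|(cF w y - cF w x) / (y - x)| <= Gam w.
  move=> xab yab xy; have yx0 : 0 < y - x by rewrite subr_gt0.
  rewrite ger0_norm; last first.
    apply: divr_ge0; last exact: ltW.
    by rewrite subr_ge0 (cumulative_is_nondecreasing (cF w)) // ltW.
  rewrite ler_pdivrMr //.
  apply: (@increment_le R a b (cF w) (D w) (Gam w) x y) => //; last exact: ltW.
  - exact: reg_continuous hreg w.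
  - exact: (reg_countable hreg w).1.
  move=> t tab tD; have [l dl] := reg_derivable hreg tab tD.
  by exists l => //; exact: Gw tab tD _ dl.
move=> x y xab yab; rewrite neq_lt => /orP[yx|xy]; last exact: incr.
by rewrite -[y - x]opprB -[cF w y - _]opprB invrN mulrNN incr.
Qed.

Context (U : {RV P >-> s.-tuple R}) (gt gt' : R -> s.-tuple R -> R).
Context (hrepr : uniform_representation a b cF U gt gt').

Local Notation E := (U @^-1` (unit_cube_ho (R := R) (s := s))).

Lemma ae_in_cube : {ae P, forall w, E w}.
Proof.
have mE := measurable_in_cube U.
exists (~` E); split; [exact: measurableC| |by []].
have := prob_in_cube (repr_uniform hrepr) => PE.
by rewrite probability_setC //; move: PE => ->; rewrite subee.
Qed.

(** Dominated convergence for the difference quotients of the conditional cdf at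
    points [y n] that tend to [x] inside [a, b]. *)
Lemma density_unbiased (x : R) : x \in `[a, b] ->
  \int[P]_(w in E) gt' x (U w) = f x.
Proof.
move=> xab; have mE := measurable_in_cube U.
(* An endpoint other than x, towards which the increments are taken. *)
pose e := if x < b then b else a.
have eab : e \in `[a, b] by rewrite /e; case: ifP => _; rewrite in_itv /= lexx (ltW hab).
have ex : e != x.
  rewrite /e; case: ltP => [/gt_eqF -> //|bx]; rewrite lt_eqF //.
  exact: lt_le_trans hab bx.
pose y n := x + (e - x) / n.+1%:R.
have yx n : y n != x.
  by rewrite /y -subr_eq0 addrC addKr mulf_neq0 ?subr_eq0 // invr_eq0 pnatr_eq0.
have yab n : y n \in `[a, b].
  move: xab eab; rewrite !in_itv /= => /andP[ax xb] /andP[ae eb].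
  have t0 : 0 <= n.+1%:R^-1 :> R by rewrite invr_ge0.
  have t1 : n.+1%:R^-1 <= 1 :> R by rewrite invf_le1 // ler1n.
  have -> : y n = (1 - n.+1%:R^-1) * x + n.+1%:R^-1 * e by rewrite /y; ring.
  move: (n.+1%:R^-1) t0 t1 => t t0 t1.
  have t10 : 0 <= 1 - t by rewrite subr_ge0.
  have a1 : 0 <= (1 - t) * (x - a) by rewrite mulr_ge0 // subr_ge0.
  have a2 : 0 <= t * (e - a) by rewrite mulr_ge0 // subr_ge0.
  have b1 : 0 <= (1 - t) * (b - x) by rewrite mulr_ge0 // subr_ge0.
  have b2 : 0 <= t * (b - e) by rewrite mulr_ge0 // subr_ge0.
  by apply/andP; split; lra.
have y_cvg : y n @[n --> \oo] --> x.
  rewrite -[X in _ --> X]addr0; apply: cvgD; first exact: cvg_cst.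
  rewrite -[X in _ --> X](mulr0 (e - x)); apply: cvgM; first exact: cvg_cst.
  exact: cvg_harmonic.
have y_within : y n @[n --> \oo] --> within `[a, b] x^'.
  move=> A; rewrite /within /= => /nbhs_ballP[r /= r0 rA].
  have /cvgrPdist_lt/(_ r r0) := y_cvg.
  apply: filterS => n xyr; exact: (rA (y n) xyr (yx n) (yab n)).
have quot_cvg F l : derivative_on a b F x l ->
    (F (y n) - F x) / (y n - x) @[n --> \oo] --> l.
  by move=> dF; exact: (cvg_comp _ _ y_within dF).
pose phi n w := ((cF w (y n) - cF w x) / (y n - x))%:E.
have int_cvg : (\int[P]_w phi n w)%E @[n --> \oo] --> (f x)%:E.
  under eq_cvg do rewrite integral_quotient.
  apply/cvg_EFin; first by near=> n.
  exact: quot_cvg (density_derivative hf xab).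
pose lim_phi := (EFin \o (gt' x \o U)) \_ E.
have mphi n : measurable_fun setT (phi n).
  apply/measurable_EFinP; apply: measurable_funM; last exact: measurable_cst.
  by apply: measurable_funB; exact: measurable_cond_cdf.
have mlim : measurable_fun setT lim_phi.
  apply/(measurable_restrictT _ mE)/measurable_EFinP.
  apply: (measurable_comp (@measurable_cube R s)) (repr_measurable hrepr xab) _.
    by move=> _ [w Ew <-]; exact: sub_cube_ho.
  exact: measurable_funTS.
have phi_lim : {ae P, forall w, setT w -> phi ^~ w @ \oo --> lim_phi w}.
  refine (filterS3 _ _ (reg_ae_derivable hreg xab) (repr_cdf hrepr) ae_in_cube).
  move=> w [l dl] repr Ew _.
  rewrite /lim_phi patchE mem_set //=.
  have -> : gt' x (U w) = l.
    apply: (repr_derivative hrepr xab (sub_cube_ho Ew)).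
    apply: cvg_trans dl; apply: near_eq_cvg; rewrite near_withinE.
    by apply: nearW => z zab; rewrite !repr.
  apply/cvg_EFin; first by near=> n.
  exact: quot_cvg dl.
(* Gam <= 1 + Gam ^ 2 turns square integrability into a dominating function. *)
have dom_int : P.-integrable setT (fun w => (1 + Gam w ^+ 2)%:E).
  have mG2 : measurable_fun setT (fun w => Gam w ^+ 2) by exact: measurable_funX.
  apply/integrableP; split.
    by apply/measurable_EFinP; apply: measurable_funD => //; exact: measurable_cst.
  have := reg_Gam_L2 hreg; rewrite unlock => G2.
  under eq_integral do rewrite gee0_abs ?lee_fin ?addr_ge0 ?sqr_ge0 // EFinD.
  rewrite ge0_integralD //=.
  - by rewrite integral_cst // mul1e lte_add_pinfty // (le_lt_trans (probability_le1 _ _)) ?ltry.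
  - by move=> w _; rewrite lee_fin sqr_ge0.
  - exact/measurable_EFinP.
have phi_dom : {ae P, forall w n, setT w -> (`|phi n w| <= (1 + Gam w ^+ 2)%:E)%E}.
  apply: filterS quotient_le => w qw n _; rewrite lee_fin.
  apply: le_trans (qw x (y n) xab (yab n) (yx n)) _; nra.
have [_ _ dom] := dominated_convergence measurableT mphi mlim phi_lim dom_int phi_dom.
have : (\int[P]_w lim_phi w = (f x)%:E)%E.
  by apply: (cvg_unique _ dom int_cvg); exact: ereal_hausdorff.
by rewrite -integral_mkcond /Rintegral => ->.
Unshelve. all: by end_near.
Qed.

End CondDensity.
(** * Second moments and rates *)

(** The integral of a nonnegative function is a supremum over the simple
    functions below it, so it is monotone even when [f] is not measurable.  The
    mean square error is not known to be measurable in [x]. *)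
Lemma le_integral_bound (d : measure_display) (T : measurableType d) (R : realType)
    (mu : {measure set T -> \bar R}) (D : set T) (f : T -> \bar R) (c : R) :
  measurable D -> 0 <= c -> (forall x, D x -> (0 <= f x <= c%:E)%E) ->
  (\int[mu]_(x in D) f x <= c%:E * mu D)%E.
Proof.
move=> mD c0 fc; rewrite -integral_cst //.
have f0 x : (0 <= (f \_ D) x)%E.
  by rewrite patchE; case: ifPn => // /set_mem /fc /andP[].
have c0' x : (0 <= (cst c%:E \_ D) x)%E.
  by rewrite patchE; case: ifPn => // _; rewrite lee_fin.
rewrite integral_mkcond [leRHS]integral_mkcond !ge0_integralTE //.
apply: ereal_sup_le => _ [h hf <-]; exists h => // x.
apply: le_trans (hf x) _; rewrite !patchE; case: ifPn => // /set_mem.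
by move/fc => /andP[].
Qed.

Section SecondMoment.
Context (R : realType) (d : measure_display) (T : measurableType d).
Variables (Q : probability T R) (Y : T -> R) (c r : R).
Hypothesis Yc : forall w, `|Y w - c| <= r.

Lemma expectation_sqr_le : ('E_Q[(fun w => (Y w - c) ^+ 2)%R] <= (r ^+ 2)%:E)%E.
Proof.
rewrite unlock -[leRHS]mule1 -(probability_setT Q).
apply: le_integral_bound => // [|w _]; first exact: sqr_ge0.
rewrite !lee_fin sqr_ge0 /= -real_normK ?num_real //.
by rewrite lerXn2r ?nnegrE // (le_trans _ (Yc w)).
Qed.

Lemma mean_close : measurable_fun setT Y -> `|fine ('E_Q[Y])%E - c| <= r.
Proof.
move=> mY.
have Yint : Q.-integrable setT (EFin \o Y).
  apply: measurable_bounded_integrable => //.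
    by rewrite (le_lt_trans (probability_le1 _ _)) ?ltry.
  exists (r + `|c|); split; first exact: num_real.
  move=> x rx w _ /=; apply: le_trans (ltW rx).
  rewrite -[Y w](subrK c); apply: le_trans (ler_normD _ _) _.
  by rewrite lerD2r.
have cint (k : R) : Q.-integrable setT (EFin \o cst k).
  exact: finite_measure_integrable_cst.
have cst_int (k : R) : \int[Q]_w k = k.
  rewrite Rintegral_cst // -[RHS]mulr1; congr (_ * _).
  by have /(congr1 fine) := probability_setT Q.
rewrite unlock -/(Rintegral Q setT Y) -[X in _ - X]cst_int -RintegralB //; last exact: cint.
have Ycint : Q.-integrable setT (EFin \o (fun w => Y w - c)).
  exact: (integrableB measurableT Yint (cint c)).
apply: le_trans (le_normr_Rintegral _ Ycint) _ => //.
rewrite -(cst_int r); apply: le_Rintegral => //; last exact: cint.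
exact: (integrable_norm Ycint).
Qed.

End SecondMoment.

(** The mean of [Y] is itself within [r] of [c]. *)
Lemma variance_le (R : realType) (d : measure_display) (T : measurableType d)
    (Q : probability T R) (Y : T -> R) (c r : R) :
  measurable_fun setT Y -> (forall w, `|Y w - c| <= r) ->
  (variance Q Y <= ((2 * r) ^+ 2)%:E)%E.
Proof.
move=> mY Yc; rewrite /variance unlock.
apply: (@expectation_sqr_le R d T Q Y (fine ('E_Q[Y])%E)) => w.
rewrite (_ : Y w - _ = (Y w - c) - (fine ('E_Q[Y])%E - c)); last by ring.
apply: le_trans (ler_normB _ _) _; rewrite mulr_natl mulr2n.
by apply: lerD; [exact: Yc|exact: mean_close].
Qed.

(** [ln y < y] at [y = x^dl] gives [ln x <= x^dl / dl]; take [dl = eps / (k + 1)]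
    and raise to the power [k]. *)
Lemma ln_powR_le (R : realType) (k : nat) (eps : R) : 0 < eps ->
  exists2 C : R, 0 <= C & forall x, 1 <= x -> ln x ^+ k <= C * x `^ eps.
Proof.
move=> e0; pose dl := eps / k.+1%:R.
have dl0 : 0 < dl by rewrite divr_gt0.
exists (dl^-1 ^+ k); first by rewrite exprn_ge0 // invr_ge0 ltW.
move=> x x1; have x0 : 0 < x by exact: lt_le_trans ltr01 x1.
have lnx : ln x <= dl^-1 * x `^ dl.
  rewrite mulrC ler_pdivlMr // mulrC -ln_powR.
  by rewrite ltW // ln_sublinear // powR_gt0.
apply: (@le_trans _ _ ((dl^-1 * x `^ dl) ^+ k)).
  by rewrite lerXn2r ?nnegrE // ?ln_ge0 // mulr_ge0 ?powR_ge0 // invr_ge0 ltW.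
rewrite exprMn ler_wpM2l ?exprn_ge0 ?invr_ge0 ?(ltW dl0) //.
rewrite -powR_mulrn ?powR_ge0 // -powRrM ler_powR //.
by rewrite /dl mulrAC ler_pdivrMr // ler_wpM2l ?(ltW e0) // ler_nat.
Qed.

Lemma log_rate_sqr_le (R : realType) (k : nat) (A eps : R) : 0 < eps ->
  exists2 C : R, 0 <= C & forall n, (0 < n)%N ->
    (A * (ln n%:R ^+ k / n%:R)) ^+ 2 <= C * n%:R `^ (-2 + eps).
Proof.
move=> e0; have [C C0 CP] := ln_powR_le (k * 2) e0.
exists (A ^+ 2 * C); first by rewrite mulr_ge0 ?sqr_ge0.
move=> n n0; have n1 : 1 <= n%:R :> R by rewrite ler1n.
have nn0 : n%:R != 0 :> R by rewrite pnatr_eq0 -lt0n.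
rewrite powRD ?nn0 ?implybT // powRN powR_mulrn //.
rewrite exprMn expr_div_n -mulrA ler_wpM2l ?sqr_ge0 // -exprM.
rewrite [leRHS]mulrCA mulrC ler_wpM2l ?invr_ge0 ?exprn_ge0 //.
exact: CP.
Qed.
(** * The rate of convergence *)

Theorem proposition3 (R : realType) (a b : R) (hab : a < b)
  (s : nat) (hs : (1 <= s)%N)
  (d : measure_display) (T : measurableType d) (P : probability T R)
  (X : {RV P >-> R}) (f : R -> R) (hf : is_density_on a b X f)
  (G : set (set T)) (hG : sub_sigma_field G)
  (cF : T -> cumulativeBounded (0 : R) (1 : R)) (hcF : is_cond_cdf G X cF)
  (D : T -> set R) (Gam : {RV P >-> R})
  (hreg : cond_cdf_regularity a b cF D Gam)
  (U : {RV P >-> s.-tuple R}) (gt gt' : R -> s.-tuple R -> R)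
  (hrepr : uniform_representation a b cF U gt gt')
  (hHK : (ereal_sup [set HK_variation (gt' x) | x in `[a, b]] < +oo)%E)
  (N : set nat) (hN : infinite_set N) (hN0 : forall n, N n -> (0 < n)%N)
  (d' : measure_display) (Om : nat -> measurableType d')
  (Q : forall n, probability (Om n) R)
  (V : forall n, 'I_n -> {RV (Q n) >-> s.-tuple R})
  (hV : rqmc_points N V)
  (eps : R) (heps : 0 < eps) :
  bigO_along N
    (fun n => ereal_sup
      [set variance (Q n) (fun w => cde_rqmc gt' (fun i => V n i w) x)
        | x in `[a, b]])
    (fun n => n%:R `^ (-2 + eps))
  /\
  bigO_along N
    (fun n => MISE a b (Q n) (fun w => cde_rqmc gt' (fun i => V n i w)) f)
    (fun n => n%:R `^ (-2 + eps)).
Proof.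
have [M gM] : exists M : R, forall x, x \in `[a, b] -> (HK_variation (gt' x) <= M%:E)%E.
  exists (fine (ereal_sup [set HK_variation (gt' x) | x in `[a, b]])) => x xab.
  have HKsup : (HK_variation (gt' x) <=
      ereal_sup [set HK_variation (gt' x) | x in `[a, b]])%E.
    by apply: ereal_sup_ubound; exists x.
  by rewrite fineK // ge0_fin_numE // (le_trans (HK_variation_ge0 _) HKsup).
have [K disc] := rqmc_discrepancy hV.
pose r n := K * `|ln n%:R ^+ s.-1 / n%:R| * M.
have error n : N n ->
    (`|ereal_sup [set star_discrepancy (fun i => V n i w) | w in [set: Om n]]|
      <= (K * `|ln n%:R ^+ s.-1 / n%:R|)%:E)%E ->
    forall x, x \in `[a, b] -> forall w, `|cde_rqmc gt' (fun i => V n i w) x - f x| <= r n.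
  move=> Nn Dn x xab w; rewrite -(density_unbiased hab hf hG hcF hreg hrepr xab).
  apply: koksma_hlawka => //.
  - exact: repr_uniform hrepr.
  - exact: hN0.
  - by move=> i; exact: (rqmc_range hV Nn i w).
  - exact: repr_measurable hrepr x xab.
  - exact: gM.
  - by apply: le_trans (le_trans (lee_abs _) Dn); apply: ereal_sup_ubound; exists w.
have mcde n x : N n -> x \in `[a, b] ->
    measurable_fun setT (fun w => cde_rqmc gt' (fun i => V n i w) x).
  move=> Nn xab; apply: measurable_funM; first exact: measurable_cst.
  apply: measurable_sum => i.
  apply: (measurable_comp (@measurable_cube R s)) (repr_measurable hrepr xab) _ => //.
  by move=> _ [w _ <-]; apply: sub_cube_ho; exact: (rqmc_range hV Nn i w).
have [C C0 rate] := log_rate_sqr_le s.-1 (K * M) heps.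
have rC n : N n -> r n ^+ 2 <= C * n%:R `^ (-2 + eps).
  move=> Nn; apply: le_trans (rate n (hN0 n Nn)).
  by rewrite /r mulrAC exprMn [leRHS]exprMn real_normK ?num_real.
have aab : a \in `[a, b] by rewrite in_itv /= lexx ltW.
split.
- exists (4 * C); apply: filterS disc => n disc Nn.
  rewrite gee0_abs; last first.
    apply: le_trans
      (variance_ge0 (Q n) (fun w => cde_rqmc gt' (fun i => V n i w) a)) _.
    by apply: ereal_sup_ubound; exists a.
  apply: ge_ereal_sup => _ [x xab <-].
  apply: le_trans (variance_le (Q n) (mcde n x Nn xab) (error n Nn (disc Nn) x xab)) _.
  rewrite lee_fin exprMn -mulrA (_ : 2 ^+ 2 = 4); last by ring.
  by rewrite ler_wpM2l // ger0_norm ?powR_ge0 //; exact: rC.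
- exists (C * (b - a)); apply: filterS disc => n disc Nn.
  rewrite gee0_abs; last first.
    by apply: integral_ge0 => x _; apply: expectation_ge0 => w; exact: sqr_ge0.
  apply: (@le_trans _ _ ((r n ^+ 2)%:E * lebesgue_measure (`[a, b]%classic : set R))%E).
    apply: le_integral_bound => //; first exact: sqr_ge0.
    move=> x xab; apply/andP; split; first by apply: expectation_ge0 => w; exact: sqr_ge0.
    have sqr_le := expectation_sqr_le (Q n) (error n Nn (disc Nn) x xab).
    exact: sqr_le.
  rewrite lebesgue_measure_itv /= lte_fin hab -EFinB -EFinM lee_fin.
  rewrite ger0_norm ?powR_ge0 // [leRHS]mulrAC ler_wpM2r ?subr_ge0 ?(ltW hab) //.
  exact: rC.
Qed.
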